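(* Let $k\ge 2$ be a positive integer. Let $F$ be a fixed $k$-uniform hypergraph with $|V(F)|>k$ and let $q$ be a positive integer with $q\leq |E(F)|$. If $G$ is a $k$-uniform hypergraph on $n$ vertices, then $$r_{\ell}(G,F,q) = O\left( n^{\frac{|V(F)|-k}{|E(F)| - q + 1}} \right)$$ as $n\to\infty$, where the implied constant may depend on $k$, $F$ and $q$ but not on $n$ or $G$.
   Context: Let $F$ and $G$ be $k$-uniform hypergraphs. An $(F,q)$-coloring of $G$ is an edge-coloring of $G$ (an arbitrary assignment of colors to edges, not necessarily proper) such that every copy of $F$ in $G$ (subhypergraph of $G$ isomorphic to $F$) receives at least $q$ distinct colors on its edges. For a positive integer $t$, a $t$-list-assignment $L$ of the edges of $G$ is a collection of lists (sets of colors) $(L(e): e\in E(G))$ such that $|L(e)|\ge t$ for all $e\in E(G)$. The generalized list Ramsey number $r_{\ell}(G,F,q)$ is the minimum $t$ such that for every $t$-list-assignment $L$ of $E(G)$ there exists an $(F,q)$-coloring $\phi$ of $G$ with $\phi(e)\in L(e)$ for all $e\in E(G)$. *)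

(* Defs.v *)
From mathcomp Require Import all_boot all_order all_classical.

Set Implicit Arguments.
Unset Strict Implicit.
Unset Printing Implicit Defensive.

Local Open Scope classical_set_scope.
Local Open Scope card_scope.
Local Open Scope nat_scope.

(* The vertex set is the whole finite type V. *)
Record hypergraph (k : nat) (V : finType) := Hypergraph {
  edges :> {set {set V}};
  edges_uniform : forall e : {set V}, e \in edges -> #|e| = k
}.

Notation edge G := {e : {set _} | e \in edges G}.

Definition is_subhypergraph (k : nat) (V : finType) (G : hypergraph k V)
    (W : {set V}) (D : {set {set V}}) : Prop :=
  D \subset edges G /\ (forall e : {set V}, e \in D -> e \subset W).

(* f, seen as a bijection from U onto W, is an isomorphism from F onto (W, D). *)
Definition is_copy (k : nat) (U V : finType) (F : hypergraph k U)
    (G : hypergraph k V) (W : {set V}) (D : {set {set V}}) : Prop :=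
  is_subhypergraph G W D /\
  exists f : U -> V, [/\ injective f, [set f u | u : U]%SET = W
    & [set f @: (e : {set U}) | e in edges F]%SET = D].

(* No properness is required; `I_q #<= A says that A has at least q elements. *)
Definition is_coloring (k : nat) (U V : finType) (F : hypergraph k U) (q : nat)
    (G : hypergraph k V) (C : Type) (phi : edge G -> C) : Prop :=
  forall (W : {set V}) (D : {set {set V}}), is_copy F G W D ->
    `I_q #<= phi @` [set e : edge G | val e \in D].

(* Colors come from an arbitrary type, and lists may be infinite. *)
Definition is_list_assignment (k : nat) (V : finType) (G : hypergraph k V)
    (t : nat) (C : Type) (L : edge G -> set C) : Prop :=
  forall e : edge G, `I_t #<= L e.

Definition list_colorable (k : nat) (U V : finType) (G : hypergraph k V)
    (F : hypergraph k U) (q t : nat) : Prop :=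
  forall (C : Type) (L : edge G -> set C), is_list_assignment t L ->
    exists phi : edge G -> C,
      is_coloring F q phi /\ (forall e : edge G, L e (phi e)).

(* The generalized list Ramsey number r_l(G, F, q): the least positive t such
   that G is colorable from all t-list-assignments.  The value 0 is only taken
   when there is no such t; by list_ramseyP this never happens if
   q <= #|edges F|. *)
Definition list_ramsey (k : nat) (U V : finType) (G : hypergraph k V)
    (F : hypergraph k U) (q : nat) : nat :=
  match pselect (exists t, `[< 0 < t /\ list_colorable G F q t >]) with
  | left exP => ex_minn exP
  | right _ => 0
  end.

Lemma list_colorable_card (k : nat) (U V : finType) (G : hypergraph k V)
    (F : hypergraph k U) (q : nat) :
  q <= #|edges F| -> list_colorable G F q #|{: edge G}|.+1.
Proof.
move=> qF C L Lt; set t := #|{: edge G}|.+1.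
have /choice[g gP] : forall e : edge G, exists h : 'I_t -> C,
    injective h /\ forall i, L e (h i).
  move=> e; have /card_leP[h] := Lt e.
  have hm (i : 'I_t) : (i : nat) \in `I_t by rewrite inE /=.
  exists (fun i => set_val (h (SigSub (hm i)))); split.
    move=> i j /val_inj /inj; rewrite !in_setT => /(_ isT isT) ij.
    by apply: val_inj; exact: (congr1 set_val ij).
  by move=> i; apply: set_valP.
have [c cP] : exists c : edge G -> 'I_t,
    {in enum {: edge G} &, injective (fun e => g e (c e))}.
  elim: (enum _) => [|e s [c cP]]; first by exists (fun=> ord0).
  have [es|es] := boolP (e \in s).
    exists c => x y; rewrite !inE => /orP[/eqP->|xs] /orP[/eqP->|ys] //;
      exact: cP.
  have [j jP] : exists j : 'I_t, forall x, x \in s -> g x (c x) <> g e j.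
    apply: contrapT => nj.
    have /choice[h hP] : forall j : 'I_t, exists x, g x (c x) = g e j.
      move=> j; apply: contrapT => nx; apply: nj; exists j => x _ xj.
      by apply: nx; exists x.
    have /leq_card : injective h.
      by move=> i j hij; apply: (gP e).1; rewrite -!hP hij.
    by rewrite card_ord ltnn.
  exists (fun x => if x == e then j else c x) => x y; rewrite !inE.
  have [->|xe] := eqVneq x e; have [->|ye] //= := eqVneq y e.
  - by move=> _ ys /esym /(jP _ ys).
  - by move=> xs _ /(jP _ xs).
  - exact: cP.
pose phi e := g e (c e).
have phi_inj : injective phi by move=> x y; apply: cP; rewrite mem_enum.
exists phi; split=> [W D [[DG _] [f [f_inj _ fD]]]|e]; last exact: (gP e).2.
have DF : #|D| = #|edges F| by rewrite -fD card_imset//; exact: imset_inj.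
rewrite (card_le_eqr (inj_card_eq _)); last by move=> x y _ _ /phi_inj.
have -> : [set e : edge G | val e \in D] =
    [set` [set e : edge G | val e \in D]%SET].
  by apply/seteqP; split=> x /=; rewrite inE.
set A := [set e : edge G | val e \in D]%SET.
have DA : D = (val @: A)%SET.
  apply/setP => x; apply/idP/imsetP => [xD|[e + ->]]; last by rewrite inE.
  by exists (exist _ x (fintype.subsetP DG _ xD)); rewrite ?inE.
have AF : #|A| = #|edges F| by rewrite -DF DA (card_imset _ val_inj).
apply: (@card_le_trans _ _ _ `I_#|A|); first by rewrite AF card_le_II.
rewrite (card_le_eql card_II).
rewrite -(card_le_eql (inj_card_eq (in2W (@enum_val_inj _ (mem A))))).
by apply: subset_card_le => _ [i _ <-] /=; exact: enum_valP.
Qed.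

Lemma list_ramseyP (k : nat) (U V : finType) (G : hypergraph k V)
    (F : hypergraph k U) (q : nat) : q <= #|edges F| ->
  [/\ 0 < list_ramsey G F q, list_colorable G F q (list_ramsey G F q) &
      forall t, 0 < t -> list_colorable G F q t -> list_ramsey G F q <= t].
Proof.
move=> qF; rewrite /list_ramsey; case: pselect => [exP|[]]; last first.
  by exists #|{: edge G}|.+1; apply/asboolP; split=> //; exact: list_colorable_card.
case: ex_minnP => m /asboolP[m0 mP] mmin; split=> // t t0 tP.
by apply: mmin; apply/asboolP.
Qed.

(* Main.v *)
Require Import Defs.
From mathcomp Require Import all_boot all_order all_algebra.
From mathcomp Require Import all_classical all_reals all_analysis.

Set Implicit Arguments.
Unset Strict Implicit.
Unset Printing Implicit Defensive.

Import Order.TTheory GRing.Theory Num.Theory.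
Import numFieldNormedType.Exports.

(** The theorem is an application of the symmetric Lovász local lemma, which is
proved here by counting.
Write [m] for the number of edges of [F] and [r = m - q + 1].  Cut every list
down to [t] colors, so that a coloring is a function from the edges of [G] to
['I_t].  If a copy [D] of [F] receives fewer than [q] colors, then some [r] of its
edges each repeat a color of one of the remaining [q - 1] edges of [D].  Fix such
a set [X] of [r] edges: once the coloring is known off [X], at most [m ^ r] of the
[t ^ r] ways to color [X] are bad.  An edge of [G] lies in [O(n ^ (|V(F)| - k))]
copies of [F]: some edge of [F] is mapped onto it, in boundedly many ways, and
the other [|V(F)| - k] vertices of [F] have at most [n] images each.  So it is
enough that [t ^ r] is at least a constant times [n ^ (|V(F)| - k)], which gives
the exponent of the theorem.

The existence of a coloring without a bad event is [exists_avoiding_all].  For a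
set [S] of edges let [good S] be the set of all colorings for which no bad
event happens within [S].  The key inequality, [card_good_step], is that adding
one edge to [S] loses at most half of [good S].  It is proved by induction on the
size of [S]: a lost coloring lies in a bad event through the new edge, with some
set [X] of repeating edges; it is still good for [S :\: X], where the colors on
[X] are free, so such colorings form a fraction of at most [m ^ r / t ^ r] of
[good (S :\: X)], and by induction [good (S :\: X)] is at most [2 ^ r] times
larger than [good S].

[exists_rainbow_choice] applies this to a family of edge sets of bounded degree,
[copy_degree] bounds the degree of the family of copies of [F], and
[list_colorable_large] combines them. *)

(** * Counting colorings that avoid local events *)

Lemma card_family_bounded (T S : finType) (X : {set T}) (w : nat)
    (A : T -> pred S) :
    (forall x, x \in X -> #|A x| <= w) ->
    (forall x, x \notin X -> #|A x| <= 1) ->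
  #|(family A : pred {ffun T -> S})| <= w ^ #|X|.
Proof.
move=> AX AN.
rewrite card_family foldrE big_map big_enum /= (bigID (mem X)) /=.
rewrite -[leqRHS]muln1 -prod_nat_const leq_mul ?leq_prod//.
by apply: leq_trans (leq_prod AN) _; rewrite big1_eq.
Qed.

(** The local lemma in the following form: the event [P i] is decided by the
coordinates in [D i], and the [r] coordinates in [X i] take at most [w] of their
[t ^ r] values once the others are known, so [w / t ^ r] plays the part of the
probability of [P i].  This last hypothesis is conditional on the coordinates off
[X i], which is what makes the counting below close under induction. *)
Section LocalLemma.
Context (E I : finType) (t r w : nat) (J : {set I}) (D X : I -> {set E}).
Context (P : I -> pred {ffun E -> 'I_t}).
Implicit Types (c : {ffun E -> 'I_t}) (S A : {set E}).

Hypothesis (r_gt0 : 0 < r) (t_gt0 : 0 < t).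
Hypothesis XD : forall i, i \in J -> X i \subset D i.
Hypothesis cardX : forall i, i \in J -> #|X i| = r.
Hypothesis P_local : forall i c c',
  i \in J -> {in D i, c =1 c'} -> P i c = P i c'.

Definition agree_off (A : {set E}) c c' := [forall e in ~: A, c e == c' e].

Hypothesis P_fibre : forall i c, i \in J ->
  #|[set c' | P i c' & agree_off (X i) c c']| <= w.
Hypothesis degree : forall e,
  #|[set i in J | e \in D i]| * (w * 2 ^ r.+1) <= t ^ r.

(** Colorings in [good S] are defined on all of [E], not only on [S]; hence the
sets [good S] for different [S] are compared without normalizing by powers
of [t]. *)
Definition good S : {set {ffun E -> 'I_t}} :=
  [set c | [forall i in J, (D i \subset S) ==> ~~ P i c]].

Lemma goodP S c :
  reflect (forall i, i \in J -> D i \subset S -> ~~ P i c) (c \in good S).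
Proof.
rewrite inE; apply: (iffP forall_inP) => h i iJ; last exact/implyP/h.
by move/implyP: (h i iJ).
Qed.

Lemma good_sub S S' : S' \subset S -> good S \subset good S'.
Proof.
move=> SS; apply/fintype.subsetP => c /goodP h; apply/goodP => i iJ DS.
exact: h iJ (fintype.subset_trans DS SS).
Qed.

Lemma agree_offC A c c' : agree_off A c c' = agree_off A c' c.
Proof. by apply: eq_forallb_in => e _; rewrite eq_sym. Qed.

(** No event within [S :\: A] looks at the coordinates in [A], so these can be
changed freely without leaving [good (S :\: A)]. *)
Lemma good_agree S A c c' :
  agree_off A c c' -> c \in good (S :\: A) -> c' \in good (S :\: A).
Proof.
move=> /forall_inP cc' /goodP h; apply/goodP => i iJ DS.
rewrite -(P_local (c := c)) ?h// => e /(fintype.subsetP DS).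
by rewrite !inE => /andP[eA _]; apply/eqP/cc'; rewrite inE.
Qed.

Lemma card_agree_off A c : t ^ #|A| <= #|[set c' | agree_off A c c']|.
Proof.
pose B e : pred 'I_t := if e \in A then predT else pred1 (c e).
have <- : #|(family B : pred {ffun E -> 'I_t})| = t ^ #|A|.
  rewrite card_family foldrE big_map big_enum /= (bigID (mem A)) /=.
  rewrite [X in _ * X]big1 ?muln1 => [|e /negPf eA]; last first.
    by rewrite /B eA card1.
  rewrite -prod_nat_const; apply: eq_bigr => e eA.
  by rewrite /B eA card_ord.
apply: subset_leq_card; apply/fintype.subsetP => c' /familyP cB.
rewrite inE; apply/forall_inP => e; rewrite inE => /negPf eA.
by have := cB e; rewrite /B eA inE eq_sym.
Qed.

(** Double counting of the pairs of colorings that agree off [X i], the first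
one in [good (S :\: X i)] and satisfying [P i], the second one in
[good (S :\: X i)]: the first has at least [t ^ r]
partners by [good_agree], and the second at most [w] by [P_fibre]. *)
Lemma card_good_bad S i : i \in J ->
  #|[set c in good (S :\: X i) | P i c]| * t ^ r <= w * #|good (S :\: X i)|.
Proof.
move=> iJ; set G := good _.
pose pairs := \sum_(c in G | P i c) \sum_(c' in G | agree_off (X i) c c') 1.
apply: (@leq_trans pairs).
  rewrite -sum_nat_const; under eq_bigl do rewrite inE.
  apply: leq_sum => c /andP[cG _]; rewrite sum1dep_card -(cardX iJ).
  apply: leq_trans (card_agree_off _ c) _; apply: subset_leq_card.
  apply/fintype.subsetP => c'; rewrite !inE => cc'; rewrite cc' andbT.
  by have := good_agree cc' cG; rewrite inE.
rewrite /pairs (exchange_big_dep (mem G)) /=; last by move=> c c' _ /andP[].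
rewrite mulnC -sum_nat_const; apply: leq_sum => c' c'G.
rewrite sum1dep_card; apply: leq_trans (P_fibre c' iJ).
apply: subset_leq_card; apply/fintype.subsetP => c; rewrite !inE.
by rewrite agree_offC => /andP[/andP[_ ->] /andP[_ ->]].
Qed.

(** The elements of [A] are put back one at a time.  All sets met on the way
before [S] are smaller than [S], so the induction hypothesis of
[card_good_step] is enough. *)
Lemma card_good_setD S :
    (forall (T : {set E}) e, #|T| < #|S| -> #|good T| <= 2 * #|good (e |: T)|) ->
  forall A, #|good (S :\: A)| <= 2 ^ #|A| * #|good S|.
Proof.
move=> IH A; move En : #|A| => n; elim: n A En => [|n IHn] A En.
  by rewrite (cards0_eq En) finset.setD0 mul1n.
have /card_gt0P[x xA] : 0 < #|A| by rewrite En.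
have {}En : #|A :\ x| = n by move: En; rewrite (cardsD1 x) xA => -[].
apply: leq_trans (_ : 2 * #|good (S :\: (A :\ x))| <= _); last first.
  by rewrite expnS -mulnA leq_mul2l/= IHn.
have SAE : S :\: A = (S :\: (A :\ x)) :\ x.
  by apply/setP => y; rewrite !inE; case: eqVneq => //= ->; rewrite xA.
have [xS|xS] := boolP (x \in S :\: (A :\ x)); last first.
  rewrite SAE (finset.setDidPl _) ?leq_pmull//.
  by rewrite disjoint_sym disjoints1.
rewrite -[in leqRHS](finset.setD1K xS) -SAE; apply: IH.
rewrite SAE; apply: leq_trans (subset_leq_card (finset.subsetDl S (A :\ x))).
by rewrite [leqRHS](cardsD1 x) xS.
Qed.

(** Rosenfeld's counting argument: each of the events through [e] removes
at most [w * 2 ^ r / t ^ r] of the set [good S], and [degree] says that these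
fractions add up to at most one half. *)
Lemma card_good_step S e : #|good S| <= 2 * #|good (e |: S)|.
Proof.
move En : #|S| => n; elim/ltn_ind: n S e En => n IHn S e En.
have IH (T : {set E}) e' : #|T| < #|S| -> #|good T| <= 2 * #|good (e' |: T)|.
  by rewrite En => Tn; exact: IHn Tn _ _ erefl.
pose Je := [set i in J | e \in D i].
pose bad i := [set c in good (S :\: X i) | P i c].
have cover_bad : good S :\: good (e |: S) \subset \bigcup_(i in Je) bad i.
  apply/fintype.subsetP => c; rewrite inE => /andP[cN cS].
  move: cN; rewrite inE negb_forall => /existsP[i].
  rewrite !negb_imply andbT => /and3P[iJ DS Pc].
  apply/bigcupP; exists i.
    rewrite inE iJ; apply: contraTT Pc => eD.
    move/goodP: cS; apply=> //; apply/fintype.subsetP => y yD.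
    have := fintype.subsetP DS y yD; rewrite !inE => /orP[/eqP ye|//].
    by rewrite -ye yD in eD.
  by rewrite inE Pc (fintype.subsetP (good_sub (finset.subsetDl S (X i)))).
have bad_small : #|good S :\: good (e |: S)| * t ^ r
    <= #|Je| * (w * 2 ^ r) * #|good S|.
  apply: (@leq_trans (\sum_(i in Je) #|bad i| * t ^ r)).
    rewrite -big_distrl leq_mul2r/=; apply/orP; right.
    apply: leq_trans (subset_leq_card cover_bad) _.
    elim/big_rec2: _ => [|i k B _ kB]; first by rewrite cards0.
    by apply: leq_trans (leq_card_setU _ _) _; rewrite leq_add2l.
  rewrite -mulnA -sum_nat_const; apply: leq_sum => i; rewrite inE => /andP[iJ _].
  apply: leq_trans (card_good_bad S iJ) _; rewrite -mulnA leq_mul2l.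
  by rewrite -(cardX iJ) (card_good_setD IH) orbT.
have half : 2 * #|good S :\: good (e |: S)| <= #|good S|.
  have tr0 : 0 < t ^ r by rewrite expn_gt0 t_gt0.
  rewrite -(leq_pmul2r tr0) -mulnA.
  apply: (@leq_trans (2 * (#|Je| * (w * 2 ^ r) * #|good S|))).
    by rewrite leq_mul2l bad_small.
  rewrite [leqRHS]mulnC mulnA leq_mul2r; apply/orP; right.
  by apply: leq_trans (degree e); rewrite expnS mulnCA (mulnCA w).
have := cardsID (good (e |: S)) (good S).
rewrite (finset.setIidPr (good_sub (finset.subsetUr _ _))) => GE.
by move: half; rewrite -GE !mul2n -!addnn leq_add2r leq_add2l.
Qed.

Lemma exists_avoiding_all : exists c, forall i, i \in J -> ~~ P i c.
Proof.
have good0 : #|good finset.set0| = t ^ #|E|.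
  rewrite -[in RHS](card_ord t) -card_ffun -cardsT; congr #|pred_of_set _|.
  apply/setP => c; rewrite [RHS]inE; apply/goodP => i iJ D0.
  have := fintype.subset_trans (XD iJ) D0; rewrite finset.subset0 => /eqP X0.
  by move: (cardX iJ) r_gt0; rewrite X0 cards0 => <-.
have : #|good ([set: E] :\: [set: E])| <= 2 ^ #|[set: E]| * #|good [set: E]|.
  by apply: card_good_setD => T e _; exact: card_good_step.
rewrite finset.setDT good0 => le_good.
have /card_gt0P[c /goodP cP] : 0 < #|good [set: E]|.
  rewrite lt0n; apply: contraTneq le_good => ->.
  by rewrite muln0 -ltnNge expn_gt0 t_gt0.
by exists c => i iJ; apply: cP iJ (finset.subsetT _).
Qed.
End LocalLemma.

(** * Choosing colors from lists in a family of edge sets *)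

Section Coloring.
Context (E : finType) (C : Type) (m q t d : nat) (H : {set {set E}}).
Context (g : E -> 'I_t -> C).

Hypothesis (q_le_m : q <= m) (t_gt0 : 0 < t).
Hypothesis cardH : forall D, D \in H -> #|D| = m.
Hypothesis degH : forall e, #|[set D in H | e \in D]| <= d.
Hypothesis g_inj : forall e, injective (g e).
Let r := (m - q).+1.
Hypothesis t_large : d * 2 ^ m * (m ^ r * 2 ^ r.+1) <= t ^ r.

(** Having fewer than [q] colors on [i.1] is split into these events, one for
each set [i.2] of [r] elements, because each of them has few solutions on [i.2]
when the colors off [i.2] are known. *)
Definition repeats (i : {set E} * {set E}) (c : {ffun E -> 'I_t}) : bool :=
  [forall x in i.2, [exists y in i.1 :\: i.2,
    `[< g x (c x) = g y (c y) >]]].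

Definition repeat_indices : {set {set E} * {set E}} :=
  [set i : {set E} * {set E} | [&& i.1 \in H, i.2 \subset i.1 & #|i.2| == r]].

Implicit Types (i : {set E} * {set E}) (c : {ffun E -> 'I_t}).

(** A repeated color at [x] is one of the at most [m] colors on
[D :\: X], and by injectivity of [g x] each of these has at most
one index. *)
Lemma repeats_fibre i c : i \in repeat_indices ->
  #|[set c' | repeats i c' & agree_off i.2 c c']| <= m ^ r.
Proof.
case: i => D X; rewrite inE /= => /and3P[DH XD /eqP Xr].
pose B x : pred 'I_t := if x \in X
  then [pred j | [exists y in D :\: X, `[< g x j = g y (c y) >]]]
  else pred1 (c x).
apply: (@leq_trans #|(family B : pred {ffun E -> 'I_t})|).
  apply: subset_leq_card; apply/fintype.subsetP => c'.
  rewrite inE => /andP[/forall_inP rep /forall_inP agr].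
  have {}agr y : y \notin X -> c' y = c y.
    by move=> yX; apply/esym/eqP/agr; rewrite inE.
  apply/familyP => x; rewrite /B; case: ifPn => xX; last by rewrite inE agr.
  rewrite inE; have /exists_inP[y yDX xy] := rep x xX.
  apply/exists_inP; exists y => //.
  by rewrite -agr//; move: yDX; rewrite inE => /andP[].
rewrite -Xr; apply: card_family_bounded => x xX; last first.
  by rewrite /B (negPf xX) card1.
rewrite /B xX -(cardH DH); apply: leq_trans (subset_leq_card (finset.subsetDl D X)).
(* [f] sends an index to an element of [D :\: X] with the same color; it is
   injective because [g x] is. *)
pose f j := [pick y in D :\: X | `[< g x j = g y (c y) >]].
have Some_inj : injective (@Some E) by move=> ? ? [].
rewrite -(card_imset _ Some_inj).
rewrite -(card_in_imset (f := f)); last first.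
  move=> j j'; rewrite !inE => /exists_inP[y yD gy] /exists_inP[y' yD' gy'].
  rewrite /f; case: pickP => [z /andP[_ /asboolP gz]|/(_ y)]; last first.
    by rewrite yD gy.
  case: pickP => [z' /andP[_ /asboolP gz'] [zz]|/(_ y')]; last first.
    by rewrite yD' gy'.
  by apply: (@g_inj x); rewrite gz gz' zz.
apply: subset_leq_card; apply/fintype.subsetP => _ /imsetP[j + ->].
rewrite inE => /exists_inP[y yD gy]; rewrite /f.
case: pickP => [z /andP[zD _]|/(_ y)]; last by rewrite yD gy.
by rewrite imset_f.
Qed.

Lemma repeats_local i (c c' : {ffun E -> 'I_t}) :
  i \in repeat_indices -> {in i.1, c =1 c'} -> repeats i c = repeats i c'.
Proof.
rewrite inE => /and3P[_ /fintype.subsetP XD _] cc'.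
apply: eq_forallb_in => x xX; apply: eq_existsb_in => y.
by rewrite inE => /andP[_ yD]; rewrite !cc'// XD.
Qed.

Lemma repeats_degree e :
  #|[set i in repeat_indices | e \in i.1]| <= d * 2 ^ m.
Proof.
pose He := [set D in H | e \in D].
apply: (@leq_trans (\sum_(D in He) #|powerset D|)); last first.
  apply: (@leq_trans (\sum_(D in He) 2 ^ m)).
    apply: leq_sum => D; rewrite inE => /andP[DH _].
    by rewrite card_powerset cardH.
  by rewrite sum_nat_const leq_mul2r degH orbT.
under [leqRHS]eq_bigr do rewrite -sum1_card.
rewrite pair_big_dep/= sum1_card; apply: subset_leq_card.
apply/fintype.subsetP => -[D X]; rewrite !inE /= => /andP[/and3P[DH XD _] eD].
by rewrite unfold_in /= !inE DH eD.
Qed.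

(** In a coloring without repeats, a largest subset [A] of [D] with distinct
colors has at least [q] elements.  Otherwise [D :\: A] contains a set [X] of [r]
elements, one of them has a color that does not occur on [D :\: X], hence not on
[A], and it could be added to [A]. *)
Lemma exists_rainbow_choice : exists c : {ffun E -> 'I_t},
  forall D, D \in H -> exists A : {set E},
    [/\ A \subset D, q <= #|A| & {in A &, injective (fun e => g e (c e))}].
Proof.
have [||||||e|c cP] := @exists_avoiding_all E _ t r (m ^ r) repeat_indices
    fst snd repeats.
- by [].
- by [].
- by move=> i; rewrite inE => /and3P[].
- by move=> i; rewrite inE => /and3P[_ _ /eqP].
- exact: repeats_local.
- exact: repeats_fibre.
- apply: leq_trans t_large; rewrite leq_mul2r.
  by rewrite repeats_degree orbT.
exists c => D DH; pose col e := g e (c e).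
pose rainbow (A : {set E}) := (A \subset D) && `[< {in A &, injective col} >].
have rainbow0 : rainbow finset.set0.
  by rewrite /rainbow finset.sub0set; apply/asboolP => x y; rewrite inE.
have [A /maxsetP[/andP[AD /asboolP Ainj] Amax] _] := maxset_exists rainbow0.
exists A; split=> //; rewrite leqNgt; apply/negP => Aq.
have rDA : r <= #|D :\: A|.
  rewrite cardsD (finset.setIidPr AD) cardH//.
  exact: ltn_sub2l (leq_trans Aq q_le_m) Aq.
have /card_gt0P[X] : 0 < #|[set X : {set E} | X \subset D :\: A & #|X| == r]|.
  by rewrite cards_draws bin_gt0.
rewrite inE => /andP[XDA Xr].
have /andP[XD AX] : (X \subset D) && [disjoint X & A] by rewrite -subsetD.
have := cP (D, X); rewrite inE /= DH XD Xr => /(_ isT).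
rewrite negb_forall_in => /exists_inP[x xX].
rewrite negb_exists_in => /forall_inP xnew.
have xA : x \notin A by rewrite (disjointFr AX xX).
have {}xnew y : y \in A -> col x <> col y.
  move=> yA; apply/asboolPn; apply: xnew.
  by rewrite inE (disjointFl AX yA) (fintype.subsetP AD).
have AxD : rainbow (x |: A).
  rewrite /rainbow finset.subUset finset.sub1set (fintype.subsetP XD _ xX) AD /=.
  apply/asboolP => y z; rewrite !inE => /orP[/eqP->|yA] /orP[/eqP->|zA] //.
  - by move/(xnew _ zA).
  - by move/esym/(xnew _ yA).
  - exact: Ainj.
have := Amax _ AxD (finset.subsetUr _ _).
by move/setP/(_ x); rewrite !inE eqxx (negPf xA).
Qed.
End Coloring.

(** * Copies of a hypergraph through an edge *)

Section Copies.
Context (k : nat) (U V : finType) (F : hypergraph k U) (G : hypergraph k V).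

(** The edge set of the copy of [F] given by [f], as a set of elements of
[edge G], the type on which colorings of [G] are defined. *)
Definition copy_in (f : {ffun U -> V}) : {set edge G} :=
  [set e | val e \in [set f @: (a : {set U}) | a in edges F]].

Definition embeddings : {set {ffun U -> V}} :=
  [set f : {ffun U -> V} | injectiveb f &
    [set f @: (a : {set U}) | a in edges F] \subset edges G].

Lemma val_copy_in f : f \in embeddings ->
  val @: copy_in f = [set f @: (a : {set U}) | a in edges F].
Proof.
rewrite inE => /andP[_ /fintype.subsetP DG].
apply/setP => x; apply/imsetP/idP => [[e + ->]|xD]; first by rewrite inE.
by exists (exist _ x (DG _ xD)); rewrite ?inE.
Qed.

Lemma card_copy_in f : f \in embeddings -> #|copy_in f| = #|edges F|.
Proof.
move=> fE; rewrite -(card_imset _ val_inj) val_copy_in//.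
move: fE; rewrite inE => /andP[/injectiveP f_inj _].
by rewrite card_imset//; exact: imset_inj.
Qed.

(** The [k] vertices of [a] have at most [k] images each, the other vertices
at most [#|V|]. *)
Lemma card_ffun_imset (a : {set U}) (e : {set V}) : #|a| = k -> #|e| = k ->
  #|[set f : {ffun U -> V} | f @: a == e]| <= k ^ k * #|V| ^ (#|U| - k).
Proof.
move=> ak ek; pose B u : pred V := if u \in a then [in e] else predT.
have <- : #|(family B : pred {ffun U -> V})| = k ^ k * #|V| ^ (#|U| - k).
  rewrite card_family foldrE big_map big_enum /= (bigID (mem a)) /=; congr (_ * _).
    have -> : k ^ k = #|e| ^ #|a| by rewrite ak ek.
    rewrite -prod_nat_const.
    by apply: eq_bigr => u ua; rewrite /B ua ek.
  have <- : #|~: a| = #|U| - k by rewrite cardsCs finset.setCK ak.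
  rewrite -prod_nat_const; apply: eq_big => u; first by rewrite inE.
  by move=> /negPf ua; rewrite /B ua.
apply: subset_leq_card; apply/fintype.subsetP => f; rewrite inE => /eqP fa.
by apply/familyP => u; rewrite /B; case: ifP => // ua; rewrite -fa; exact: imset_f.
Qed.

Lemma copy_degree (e : edge G) :
  #|[set D in copy_in @: embeddings | e \in D]|
    <= #|edges F| * (k ^ k * #|V| ^ (#|U| - k)).
Proof.
pose through (a : {set U}) := [set f : {ffun U -> V} | f @: a == val e].
apply: (@leq_trans #|\bigcup_(a in edges F) through a|).
  apply: leq_trans (leq_imset_card copy_in _); apply: subset_leq_card.
  apply/fintype.subsetP => _ /[!inE] /andP[/imsetP[f _ ->]].
  rewrite inE => /imsetP[a aF ea]; apply/imsetP; exists f => //.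
  by apply/bigcupP; exists a; rewrite // inE ea.
apply: (@leq_trans (\sum_(a in edges F) #|through a|)).
  elim/big_rec2: _ => [|a n B _ nB]; first by rewrite cards0.
  by apply: leq_trans (leq_card_setU _ _) _; rewrite leq_add2l.
rewrite -sum_nat_const; apply: leq_sum => a aF.
exact: card_ffun_imset (edges_uniform aF) (edges_uniform (valP e)).
Qed.

(** The degree of the family of copies, without its power of [#|V|], times the
constants in the hypothesis of [exists_rainbow_choice]. *)
Definition ramsey_const q : nat := let m := #|edges F| in
  m * k ^ k * 2 ^ m * (m ^ (m - q).+1 * 2 ^ (m - q).+2).

Lemma list_colorable_large (q t : nat) :
  q <= #|edges F| -> 0 < t ->
  ramsey_const q * #|V| ^ (#|U| - k) <= t ^ (#|edges F| - q).+1 ->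
  list_colorable G F q t.
Proof.
move=> qF t0 t_large C L Lt.
(* Only [t] colors of each list are kept, numbered by ['I_t]. *)
have /choice[g gP] : forall e : edge G, exists h : 'I_t -> C,
    injective h /\ forall i, L e (h i).
  move=> e; have /card_leP[h] := Lt e.
  have hm (i : 'I_t) : ((i : nat) \in `I_t)%classic by rewrite inE /=.
  exists (fun i => set_val (h (SigSub (hm i)))); split.
    move=> i j /val_inj /inj; rewrite !in_setT => /(_ isT isT) ij.
    by apply: val_inj; exact: (congr1 set_val ij).
  by move=> i; exact: set_valP.
have [||||||c cP] := @exists_rainbow_choice _ C #|edges F| q t
    (#|edges F| * (k ^ k * #|V| ^ (#|U| - k))) (copy_in @: embeddings) g.
- by [].
- by [].
- by move=> _ /imsetP[f fE ->]; exact: card_copy_in.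
- exact: copy_degree.
- by move=> e; exact: (gP e).1.
- apply: leq_trans t_large; rewrite /ramsey_const.
  by move: (#|V| ^ _) => N; rewrite -!mulnA (mulnC N) -!mulnA.
exists (fun e => g e (c e)); split=> [W D [[DG _] [f [f_inj _ fD]]]|e]; last first.
  exact: (gP e).2.
pose f' := [ffun u => f u].
have ff' (a : {set U}) : f' @: a = f @: a by apply: eq_imset => u; rewrite ffunE.
have fD' : [set f' @: (a : {set U}) | a in edges F] = D.
  by rewrite -fD; apply: eq_imset.
have fE : f' \in embeddings.
  rewrite inE fD' DG andbT; apply/injectiveP => u v.
  by rewrite !ffunE; exact: f_inj.
have [A [AD qA Ainj]] := cP _ (imset_f copy_in fE).
apply: (@card_le_trans _ _ _ `I_#|A|); first by rewrite card_le_II.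
apply: (@card_le_trans _ _ _ [set` A]%classic).
  rewrite (card_le_eql card_II).
  rewrite -(card_le_eql (inj_card_eq (in2W (@enum_val_inj _ (mem A))))).
  by apply: subset_card_le => _ [i _ <-] /=; exact: enum_valP.
have Ainj' : set_inj [set` A]%classic (fun e => g e (c e)).
  by move=> x y /set_mem xA /set_mem yA; exact: Ainj.
rewrite -(card_le_eql (inj_card_eq Ainj')).
apply/subset_card_le/image_subset => e /= /(fintype.subsetP AD).
by rewrite inE fD'.
Qed.
End Copies.

(** * The asymptotic bound *)

Local Open Scope classical_set_scope.
Local Open Scope ring_scope.

Theorem theorem1p5 (R : realType) (k : nat) (U : finType)
    (F : hypergraph k U) (q : nat) :
  (2 <= k)%N -> (k < #|U|)%N -> (0 < q)%N -> (q <= #|edges F|)%N ->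
  exists2 c : R, 0 < c &
    \forall n \near \oo, forall (V : finType) (G : hypergraph k V),
      #|V| = n ->
      (list_ramsey G F q)%:R <=
        c * n%:R `^ ((#|U|%:R - k%:R) / (#|edges F|%:R - q%:R + 1)).
Proof.
move=> k2 kU q0 qF; set alpha := _ / _.
pose K := ramsey_const F q; pose r := (#|edges F| - q).+1.
exists (K%:R + 1); first by rewrite ltr_wpDl.
near=> n => V G Vn.
have n1 : 1 <= n%:R :> R by rewrite ler1n; near: n; exact: nbhs_infty_ge.
have alphaE : alpha = (#|U| - k)%:R / r%:R.
  by rewrite /alpha /r -addn1 natrD !natrB// ltnW.
have alpha0 : 0 <= alpha by rewrite alphaE divr_ge0.
have na1 : 1 <= n%:R `^ alpha by rewrite -[leLHS](powRr0 n%:R) ler_powR.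
have nar : (n%:R `^ alpha) ^+ r = n%:R ^+ (#|U| - k) :> R.
  rewrite -powR_mulrn ?powR_ge0// -powRrM alphaE divfK ?pnatr_eq0//.
  by rewrite powR_mulrn// (le_trans ler01).
(* [s ^+ r] is at least [K * n ^ (#|U| - k)] because [r] is
   positive and hence [K <= K ^ r]. *)
set s := K%:R * n%:R `^ alpha; pose t := (Num.truncn s).+1.
have s0 : 0 <= s by rewrite mulr_ge0// powR_ge0.
have st : s < t%:R by rewrite /t truncnS_gt.
have ts : t%:R <= (K%:R + 1) * n%:R `^ alpha.
  by rewrite mulrDl mul1r /t -addn1 natrD lerD// truncn_le.
apply: le_trans ts; rewrite ler_nat.
have [_ _] := list_ramseyP G qF; apply => //.
apply: list_colorable_large => //; rewrite -/K -/r Vn.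
rewrite -(ler_nat R) natrM !natrX -nar.
apply: (@le_trans _ _ (s ^+ r)); last by rewrite lerXn2r ?nnegrE// ltW.
rewrite /s exprMn ler_wpM2r ?exprn_ge0 ?powR_ge0//.
have [->|K0] := eqVneq K 0%N; first by rewrite expr0n.
by rewrite -natrX ler_nat -[leqLHS]expn1 leq_pexp2l// lt0n.
Unshelve. all: by end_near.
Qed.
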